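(* For all $\varepsilon>0$ and $s\in[0,1/3)$, there is $n_0\in\mathbb{N}$ such that the following holds. Suppose $G$ is a graph with $n\geq n_0$ vertices such that $\rho(G)\geq n^{1-s}$, and $k\in\mathbb{N}$ satisfies $$k\ \geq\ (1+\varepsilon)\left(1+\frac{s}{1-2s}\right)\frac{\rho(G)}{\ln\rho(G)}.$$ Then $G$ is $k$-DP-colorable with probability at least $1-\varepsilon$.
   Context: All graphs are finite and simple. $\mathbb{N}=\{0,1,2,\ldots\}$ and $[k]=\{1,\ldots,k\}$. The density of a nonempty graph $G$ is $d(G)=|E(G)|/|V(G)|$; the maximum density is $\rho(G)=\max_{G'} d(G')$, the maximum being over all nonempty subgraphs $G'$ of $G$. A (DP-)cover of $G$ is a pair $\mathcal{H}=(L,H)$ where $H$ is a graph and $L:V(G)\to 2^{V(H)}$ is such that: $\{L(v):v\in V(G)\}$ is a partition of $V(H)$ into $|V(G)|$ independent sets; for each edge $uv\in E(G)$ the edges of $H$ between $L(u)$ and $L(v)$ form a matching; and $H$ has no other edges than those between $L(u)$ and $L(v)$ with $uv\in E(G)$. A transversal is a set $T\subseteq V(H)$ containing exactly one vertex of each $L(v)$; it is independent if it is an independent set in $H$. $G$ is $\mathcal{H}$-colorable if $\mathcal{H}$ has an independent transversal. For $k\in\mathbb{N}$, the random $k$-fold cover $\mathcal{H}(G,k)=(L,H)$ is defined by $L(v)=\{(v,i):i\in[k]\}$ for $v\in V(G)$ and, independently for each edge $uv\in E(G)$, the edges of $H$ between $L(u)$ and $L(v)$ form a perfect matching chosen uniformly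 at random among the $k!$ perfect matchings between $L(u)$ and $L(v)$ ($H$ has no other edges). We say $G$ is $k$-DP-colorable with probability $p$ if $\mathbb{P}(G\text{ is }\mathcal{H}(G,k)\text{-colorable})=p$ (and similarly for ''at most'', ''at least'', ''less than''). *)

(* Defs.v *)
From mathcomp Require Import all_boot all_order all_algebra all_fingroup.
From mathcomp Require Import reals.

Set Implicit Arguments.
Unset Strict Implicit.
Unset Printing Implicit Defensive.

Import Order.TTheory GRing.Theory Num.Theory.
Local Open Scope ring_scope.

(* A graph on the vertex type [V] is given by its edge set [E : {set {set V}}],
   whose members must be two-element sets. *)

Definition simple_graph (V : finType) (E : {set {set V}}) : bool :=
  [forall e in E, #|e| == 2%N].

Definition subgraph (V : finType) (E : {set {set V}})
    (W : {set V}) (F : {set {set V}}) : bool :=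
  (F \subset E) && (F \subset powerset W).

Definition density (R : realType) (V : finType)
    (W : {set V}) (F : {set {set V}}) : R :=
  #|F|%:R / #|W|%:R.

(* The default value 0 only matters when [V] is empty, since densities are
   nonnegative. *)
Definition max_density (R : realType) (V : finType) (E : {set {set V}}) : R :=
  \big[Num.max/0]_(S : {set V} * {set {set V}} |
      (S.1 != set0) && subgraph E S.1 S.2) density R S.1 S.2.

Definition independent (X : finType) (E : {set {set X}}) (A : {set X}) : bool :=
  [forall e in E, ~~ (e \subset A)].

Definition edges_between (X : finType) (H : {set {set X}}) (A B : {set X}) :
    {set {set X}} :=
  [set f in H | [exists x in A, exists y in B, f == [set x; y]]].

(* The parts [L v] may be empty, so that 0-fold covers are covers. *)
Definition is_dp_cover (V X : finType) (E : {set {set V}})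
    (L : V -> {set X}) (H : {set {set X}}) : Prop :=
  [/\ simple_graph H,
      (forall u v, u != v -> [disjoint L u & L v])
        /\ \bigcup_(v : V) L v = [set: X],
      forall v, independent H (L v),
      forall u v, [set u; v] \in E -> trivIset (edges_between H (L u) (L v))
    & forall f, f \in H ->
        exists u v, [set u; v] \in E /\ f \in edges_between H (L u) (L v)].

Definition transversal (V X : finType) (L : V -> {set X}) (T : {set X}) : bool :=
  [forall v, #|T :&: L v| == 1%N].

Definition colorable (V X : finType) (L : V -> {set X}) (H : {set {set X}}) :
    bool :=
  [exists T : {set X}, transversal L T && independent H T].

Definition fiber (V : finType) (k : nat) (v : V) : {set V * 'I_k} :=
  [set (v, i) | i : 'I_k].

(* For an edge [e = {u, v}], these are the perfect matchings between the fibers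
   of [u] and [v]: the sets of pairs that partition the union of both fibers,
   each pair having one vertex in each fiber. *)
Definition perfect_matchings (V : finType) (k : nat) (e : {set V}) :
    {set {set {set V * 'I_k}}} :=
  [set M | partition M (\bigcup_(v in e) fiber k v)
         & [forall B in M, forall v in e, #|B :&: fiber k v| == 1%N]].

Definition edge (V : finType) (E : {set {set V}}) : finType := {e | e \in E}.

Definition outcome (V : finType) (E : {set {set V}}) (k : nat) : finType :=
  {ffun edge E -> {set {set V * 'I_k}}}.

Definition cover_edges (V : finType) (E : {set {set V}}) (k : nat)
    (w : outcome E k) : {set {set V * 'I_k}} :=
  \bigcup_(e : edge E) w e.

Definition uniform_pmf (R : realType) (X : finType) (A : {set X}) (x : X) : R :=
  (x \in A)%:R / #|A|%:R.

(* Independence of the matchings: their joint law is the product law. *)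
Definition cover_pmf (R : realType) (V : finType) (E : {set {set V}}) (k : nat)
    (w : outcome E k) : R :=
  \prod_(e : edge E) uniform_pmf R (perfect_matchings k (val e)) (w e).

Definition prob_DP_colorable (R : realType) (V : finType) (E : {set {set V}})
    (k : nat) : R :=
  \sum_(w : outcome E k | colorable (@fiber V k) (cover_edges w)) cover_pmf R w.

Lemma in_fiber (V : finType) (k : nat) (v : V) (x : V * 'I_k) :
  (x \in fiber k v) = (x.1 == v).
Proof.
apply/imsetP/eqP => [[i _ ->] //|<-].
by exists x.2 => //; case: x.
Qed.

Lemma perfect_matchingsP (V : finType) (k : nat) (u v : V)
    (M : {set {set V * 'I_k}}) : u != v ->
  reflect (exists s : {perm 'I_k}, M = [set [set (u, i); (v, s i)] | i : 'I_k])
          (M \in perfect_matchings k [set u; v]).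
Proof.
move=> uv; have vu : v != u by rewrite eq_sym.
have bigE : \bigcup_(w in [set u; v]) fiber k w = fiber k u :|: fiber k v.
  by rewrite big_setU1 ?inE //= big_set1.
apply: (iffP idP).
- rewrite inE bigE => /andP[/and3P[/eqP covM tM _]] /forall_inP cM.
  have ucov i : (u, i) \in cover M by rewrite covM !inE !in_fiber eqxx.
  pose B i := pblock M (u, i).
  have BM i : B i \in M by apply: pblock_mem.
  have uB i : (u, i) \in B i by rewrite mem_pblock.
  have c1 C w : C \in M -> w \in [set u; v] -> #|C :&: fiber k w| = 1%N.
    by move=> CM we; apply/eqP; have /forall_inP := cM C CM; apply.
  have jex i : exists j, (v, j) \in B i.
    have /eqP/cards1P[[w j] Bj] := c1 _ v (BM i) (set22 _ _).
    have : (w, j) \in B i :&: fiber k v by rewrite Bj set11.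
    by rewrite inE in_fiber => /andP[h /eqP /= e]; exists j; rewrite -e.
  pose s i := xchoose (jex i).
  have sB i : (v, s i) \in B i := xchooseP (jex i).
  have uniq C w i j : C \in M -> w \in [set u; v] ->
      (w, i) \in C -> (w, j) \in C -> i = j.
    move=> CM we hi hj; have /eqP/cards1P[x Cx] := c1 _ _ CM we.
    have : (w, i) \in C :&: fiber k w by rewrite inE hi in_fiber /=.
    have : (w, j) \in C :&: fiber k w by rewrite inE hj in_fiber /=.
    by rewrite Cx !inE => /eqP <- /eqP[].
  have s_inj : injective s.
    move=> i j sij; have eB : B i = B j.
      apply: (@def_pblock _ M) => //; rewrite ?BM //.
      rewrite -(def_pblock tM (BM j) (sB j)) -sij.
      by rewrite (def_pblock tM (BM i) (sB i)) //.
    by apply: (uniq (B i) u) => //; rewrite ?set21 // eB.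
  have BE i : B i = [set (u, i); (v, s i)].
    apply/setP => -[w j]; rewrite !inE !xpair_eqE; apply/idP/orP.
    + move=> h; have : (w, j) \in cover M by apply/bigcupP; exists (B i).
      rewrite covM inE !in_fiber /= => /orP[] /eqP ew; subst w; [left|right];
        rewrite eqxx /=; apply/eqP.
      * by apply: (uniq (B i) u); rewrite ?set21.
      * by apply: (uniq (B i) v); rewrite ?set22.
    + by case=> /andP[/eqP-> /eqP->].
  exists (perm s_inj); apply/setP => C; apply/idP/imsetP.
  + move=> CM; have /eqP/cards1P[[w i] Ci] := c1 _ u CM (set21 _ _).
    have : (w, i) \in C :&: fiber k u by rewrite Ci set11.
    rewrite inE in_fiber /= => /andP[h /eqP ew]; subst w.
    by exists i => //; rewrite permE -BE; apply/esym/def_pblock.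
  + by case=> i _ ->; rewrite permE -BE.
- case=> s ->; rewrite inE bigE; apply/andP; split; last first.
    apply/forall_inP => _ /imsetP[i _ ->]; apply/forall_inP => w.
    rewrite !inE => /orP[] /eqP->; apply/cards1P;
      [exists (u, i)|exists (v, s i)]; apply/setP => -[w' j];
      rewrite !inE in_fiber !xpair_eqE /=.
    + by have [->|_] := eqVneq w' u; rewrite ?andbF // (negPf uv) !andbT orbF.
    + by have [->|_] := eqVneq w' v; rewrite ?andbF // (negPf vu) !andbT.
  apply/and3P; split.
  + apply/eqP/setP => -[w j]; rewrite inE !in_fiber /=.
    apply/bigcupP/orP.
    * by case=> _ /imsetP[i _ ->]; rewrite !inE !xpair_eqE
        => /orP[] /andP[-> _]; [left|right].
    * case=> /eqP->.
      + exists [set (u, j); (v, s j)]; last by rewrite set21.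
        by apply/imsetP; exists j.
      + exists [set (u, (s^-1)%g j); (v, s ((s^-1)%g j))];
          last by rewrite permKV set22.
        by apply/imsetP; exists ((s^-1)%g j).
  + apply/trivIsetP => _ _ /imsetP[i _ ->] /imsetP[j _ ->] ne.
    have nij : i != j by apply: contraNneq ne => ->.
    apply/pred0P => -[w l]; rewrite /= !inE !xpair_eqE.
    apply/negP => /andP[/orP[] /andP[/eqP-> /eqP->]];
      rewrite eqxx ?(negPf uv) ?(negPf vu) /= ?orbF.
    * by rewrite (negPf nij).
    * by rewrite (inj_eq perm_inj) (negPf nij).
  + apply/negP => /imsetP[i _] /setP/(_ (u, i)).
    by rewrite !inE eqxx.
Qed.

Lemma card_perfect_matchings (V : finType) (k : nat) (e : {set V}) :
  #|e| = 2%N -> #|perfect_matchings k e| = k`!.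
Proof.
move=> /eqP/cards2P[u [v [uv ->]]].
pose M (s : {perm 'I_k}) := [set [set (u, i); (v, s i)] | i : 'I_k].
have -> : perfect_matchings k [set u; v] = [set M s | s : {perm 'I_k}].
  apply/setP => N; apply/(perfect_matchingsP _ uv)/imsetP.
  - by case=> s ->; exists s.
  - by case=> s _ ->; exists s.
rewrite card_imset ?card_Sn // => s t est; apply/permP => i.
have : [set (u, i); (v, s i)] \in M t by rewrite -est; apply/imsetP; exists i.
case/imsetP => j _ /setP est'.
have := est' (u, i); rewrite !inE !xpair_eqE !eqxx (negPf uv) /= orbF.
move=> /esym/eqP eij; subst j.
have := est' (v, s i).
by rewrite !inE !xpair_eqE !eqxx orbT eq_sym (negPf uv) /= => /esym/eqP.
Qed.

Lemma cover_pmf_ge0 (R : realType) (V : finType) (E : {set {set V}}) (k : nat)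
    (w : outcome E k) : 0 <= cover_pmf R w.
Proof. by apply: prodr_ge0 => e _; rewrite divr_ge0. Qed.

Lemma sum_cover_pmf (R : realType) (V : finType) (E : {set {set V}}) (k : nat) :
  simple_graph E -> \sum_(w : outcome E k) cover_pmf R w = 1.
Proof.
move=> /forall_inP sE; rewrite /cover_pmf.
rewrite -(bigA_distr_bigA (fun (e : edge E) M =>
  uniform_pmf R (perfect_matchings k (val e)) M)).
apply: big1 => e _; rewrite /uniform_pmf -mulr_suml -natr_sum.
have -> : (\sum_M (M \in perfect_matchings k (val e)))%N
    = #|perfect_matchings k (val e)| by rewrite -sum1_card [RHS]big_mkcond.
rewrite divff // pnatr_eq0 card_perfect_matchings -?lt0n ?fact_gt0 //.
exact/eqP/sE/(valP e).
Qed.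

Lemma cover_edges_dp_cover (R : realType) (V : finType) (E : {set {set V}})
    (k : nat) (w : outcome E k) :
  simple_graph E -> cover_pmf R w != 0 ->
  is_dp_cover E (@fiber V k) (cover_edges w).
Proof.
move=> /forall_inP sE /prodf_neq0 w0.
have wM e : w e \in perfect_matchings k (val e).
  have := w0 e isT; rewrite /uniform_pmf; case: (w e \in _) => //.
  by rewrite mul0r eqxx.
have coverP f : f \in cover_edges w -> exists e u v i j,
    [/\ val e = [set u; v], u != v, f \in w e & f = [set (u, i); (v, j)]].
  case/bigcupP => e _ fe.
  have /cards2P[u [v [uv euv]]] := sE _ (valP e).
  have := wM e; rewrite euv => /(perfect_matchingsP _ uv)[s we].
  by move: (fe); rewrite we => /imsetP[i _ ->]; exists e, u, v, i, (s i);
    split=> //; rewrite we; apply/imsetP; exists i.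
split.
- apply/forall_inP => f /coverP[e [u [v [i [j [_ uv _ ->]]]]]].
  by rewrite cards2 xpair_eqE (negPf uv).
- split=> [u v uv|].
    apply/pred0P => x; rewrite /= !in_fiber; apply/negP => /andP[/eqP xu /eqP xv].
    by rewrite -xu -xv eqxx in uv.
  apply/setP => x; rewrite inE; apply/bigcupP; exists x.1 => //.
  by rewrite in_fiber.
- move=> z; apply/forall_inP => f /coverP[e [u [v [i [j [_ uv _ ->]]]]]].
  apply/negP => /subsetP sz.
  have := sz (u, i); have := sz (v, j).
  rewrite !in_fiber !inE !eqxx orbT /= => /(_ isT)/eqP ev /(_ isT)/eqP eu.
  by rewrite eu ev eqxx in uv.
- move=> u v uvE.
  have eP f : f \in edges_between (cover_edges w) (fiber k u) (fiber k v) ->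
      f \in w (Sub [set u; v] uvE).
    rewrite inE => /andP[/coverP[e [a [b [i [j [eab ab fe ef]]]]]]].
    case/exists_inP => x xu /exists_inP[y yv /eqP fxy].
    suff -> : Sub [set u; v] uvE = e by [].
    apply: val_inj; rewrite /= eab.
    have im (x' y' : V * 'I_k) :
        [set fst z | z in [set x'; y']] = [set x'.1; y'.1] :> {set V}.
      by rewrite imsetU1 imset_set1.
    have -> : [set a; b] = [set fst z | z in f] by rewrite ef im.
    by rewrite fxy im //; move: xu yv; rewrite !in_fiber => /eqP-> /eqP->.
  have := wM (Sub [set u; v] uvE).
  rewrite inE => /andP[/and3P[_ /trivIsetP tw _] _].
  by apply/trivIsetP => A B /eP hA /eP hB; apply: tw.
- move=> f fC; have [e [u [v [i [j [euv uv _ ef]]]]]] := coverP f fC.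
  exists u, v; split; first by rewrite -euv (valP e).
  rewrite inE fC; apply/exists_inP; exists (u, i); first by rewrite in_fiber.
  by apply/exists_inP; exists (v, j); rewrite ?in_fiber //= ef.
Qed.

(* Main.v *)
Require Import Defs.
From mathcomp Require Import all_boot all_order all_algebra all_fingroup.
From mathcomp Require Import ring lra.
From mathcomp Require Import reals sequences exp.

Import Order.TTheory GRing.Theory Num.Theory.
Local Open Scope ring_scope.

Set Implicit Arguments.
Unset Strict Implicit.
Unset Printing Implicit Defensive.

(** The proof is a second moment argument. Write [n] for the number of vertices,
    [rho] for the maximum density, and let [X] be the number of independent
    transversals of the random cover, a transversal being the graph of a map
    [f] from the vertices to ['I_k]. By Cauchy-Schwarz the cover is colorable
    with probability at least (E X)^2 / E X^2, so it suffices to show that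
    E X^2 is at most (1 + o(1)) (E X)^2.

    The edges carry independent random permutations, so both moments factor
    over the edges. One transversal avoids the matching of an edge with
    probability 1 - 1/k, whence E X = k^n (1 - 1/k)^m ([first_moment]). Two
    transversals [f] and [g] both avoid it with probability at most
    (1 - 1/k)^2 (1 + (k - 1)^-3), except that an additional factor
    k / (k - 1) appears when [f] and [g] agree at both ends of the edge
    ([prob_avoid2]). Hence E X^2 / (E X)^2 is at most
    (1 + (k - 1)^-3)^m times the average over [f] and [g] of
    (k / (k - 1))^e(S), where [S] is the set of vertices at which [f] and [g]
    agree and e(S) is the number of edges inside [S] ([second_moment]).

    For a fixed [f] and a uniformly random [g] the size of [S] is binomial with
    mean n / k. Two bounds on e(S) are available: |S|^2, good for small sets, and
    rho |S|, good for large ones. Fix a cutoff [J] slightly above a large multiple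
    of n / k. If |S| is at most [J], then (k / (k - 1))^e(S) is at most
    exp (J^2 / (k - 1)); if |S| lies between [J] and k - 1 it is at most exp |S|;
    beyond that it is at most exp (rho |S| / (k - 1)). The last two ranges have
    tiny probability, and exponential tilting (multiplying by exp (|S| - J),
    respectively exp (|S| - (k - 1)), which is at least 1 there) reduces all three
    to the moment generating function of the binomial law ([pointwise_bound],
    [sum_agree]). The result is the explicit bound [prob_DP_colorable_ge].

    It remains to see that the bound tends to 1. Put y = ln rho and
    a = 1 / (1 - s), so that n is at most exp (a y), and
    k >= (1 + eps) / (2 - a) * exp y / y. Up to factors exp (o(y)), the errors are
    rho n / k^3 = exp ((a - 2) y), J^2 / k = exp ((2 a - 3) y) and
    n exp (rho / k) / k^2 = exp ((a + b - 2) y) with b slightly above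
    (2 - a) / (1 + eps). The second exponent is negative exactly because
    s < 1 / 3, and the third one exactly because of the constant
    1 + s / (1 - 2 s) = 1 / (2 - a) in the lower bound on [k]
    ([eventually_small_errors]). *)

(** * Uniformly random permutations *)

(** Composing with a transposition shows that the image of [a] is uniformly
    distributed. *)
Lemma sum_perm1 (R : realType) (k : nat) (a b : 'I_k) :
  \sum_(s : 'S_k) (s a == b)%:R = k`!%:R / k%:R :> R.
Proof.
have k0 : k%:R != 0 :> R by rewrite pnatr_eq0 -lt0n (leq_ltn_trans _ (ltn_ord a)).
have sym c : \sum_(s : 'S_k) (s a == c)%:R = \sum_(s : 'S_k) (s a == b)%:R :> R.
  rewrite (reindex_inj (mulIg (tperm b c))) /=.
  apply: eq_bigr => s _; rewrite permM -{2}(tpermL b c).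
  by rewrite (inj_eq perm_inj).
apply: (canRL (mulfK k0)).
rewrite mulr_natr -[in X in _ *+ X](card_ord k) -sumr_const.
rewrite -(eq_bigr _ (fun c _ => sym c)) exchange_big /=.
under eq_bigr => s _.
  rewrite (bigD1 (s a)) //= eqxx big1 ?addr0; last first.
    by move=> c /negPf h; rewrite eq_sym h.
  over.
by rewrite sumr_const card_Sn.
Qed.

(** Given that [a] goes to [b], the image of [a'] is uniform among the other
    points: a transposition of two of these keeps [b] fixed. *)
Lemma sum_perm2 (R : realType) (k : nat) (a a' b b' : 'I_k) :
  a != a' -> b != b' ->
  \sum_(s : 'S_k) ((s a == b) && (s a' == b'))%:R
    = k`!%:R / (k%:R * k.-1%:R) :> R.
Proof.
move=> aa bb.
have k1 : k.-1%:R != 0 :> R.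
  rewrite pnatr_eq0 -lt0n; case: k a a' aa {b b' bb} => [[] //|[|//]] i j.
  by rewrite !ord1.
have sym c : c != b ->
    \sum_(s : 'S_k) ((s a == b) && (s a' == c))%:R
      = \sum_(s : 'S_k) ((s a == b) && (s a' == b'))%:R :> R.
  move=> cb; rewrite (reindex_inj (mulIg (tperm b' c))) /=.
  apply: eq_bigr => s _; rewrite !permM -{3}(tpermL b' c) (inj_eq perm_inj).
  have {1}-> : b = tperm b' c b by rewrite tpermD // eq_sym.
  by rewrite (inj_eq perm_inj).
rewrite invfM mulrA -(sum_perm1 R a b); apply: (canRL (mulfK k1)).
have -> : k.-1 = #|[pred c : 'I_k | c != b]|.
  by have := cardC1 b; rewrite card_ord => <-.
rewrite mulr_natr -sumr_const.
under eq_bigr => c cb do rewrite -(sym c) //.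
rewrite exchange_big /=; apply: eq_bigr => s _.
case: (eqVneq (s a) b) => [sab|_] /=; last by rewrite big1.
have h : s a' != b by rewrite -sab (inj_eq perm_inj) eq_sym.
rewrite (bigD1 (s a')) //= eqxx big1 ?addr0 // => c /andP[_ /negPf h'].
by rewrite eq_sym h'.
Qed.

Lemma prob_avoid1 (R : realType) (k : nat) (a b : 'I_k) :
  (\sum_(s : 'S_k) (s a != b)%:R) / k`!%:R = 1 - k%:R^-1 :> R.
Proof.
have f0 : k`!%:R != 0 :> R by rewrite pnatr_eq0 -lt0n fact_gt0.
under eq_bigr => s _ do
  (have -> : (s a != b)%:R = 1 - (s a == b)%:R :> R by case: eqP => _ /=; lra).
rewrite sumrB sumr_const card_Sn sum_perm1 mulrBl divff //.
by rewrite mulrAC divff // mul1r.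
Qed.

(** Inclusion-exclusion. When the two conditions involve distinct points and
    distinct images, the joint probability is 1 - 2/k + 1/(k (k - 1)), which
    equals (1 - 1/k)^2 (1 + (k - 1)^-3). If exactly one of the two coincidences
    holds, the events excluded are disjoint and the probability 1 - 2/k is below
    (1 - 1/k)^2. If both hold, there is a single condition, and 1 - 1/k exceeds
    (1 - 1/k)^2 by the factor k / (k - 1). *)
Lemma prob_avoid2 (R : realType) (k : nat) (a a' b b' : 'I_k) : (1 < k)%N ->
  (\sum_(s : 'S_k) ((s a != b) && (s a' != b'))%:R) / k`!%:R
    <= (1 - k%:R^-1) ^+ 2 * (1 + (k%:R - 1) ^- 3)
       * (if (a == a') && (b == b') then k%:R / (k%:R - 1) else 1) :> R.
Proof.
move=> k1.
have f0 : k`!%:R != 0 :> R by rewrite pnatr_eq0 -lt0n fact_gt0.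
have K1 : 0 < k%:R - 1 :> R by rewrite subr_gt0 ltr1n.
have kE : k.-1%:R = k%:R - 1 :> R by rewrite -subn1 natrB // ltnW.
set K : R := k%:R in K1 kE *.
have K0 : 0 < K by lra.
have K3 : 0 < (K - 1) ^- 3 by rewrite invr_gt0 exprn_gt0.
case: (eqVneq a a') => [<-|aa]; case: (eqVneq b b') => [<-|bb] /=.
- under eq_bigr => s _ do rewrite andbb.
  rewrite prob_avoid1 -/K.
  have {1}-> : 1 - K^-1 = (1 - K^-1) ^+ 2 * 1 * (K / (K - 1)) by field; lra.
  apply: ler_wpM2r; first by apply: divr_ge0; exact: ltW.
  by apply: ler_wpM2l; rewrite ?sqr_ge0 // lerDl; exact: ltW.
- under eq_bigr => s _ do
    (have -> : ((s a != b) && (s a != b'))%:R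
         = 1 - (s a == b)%:R - (s a == b')%:R :> R by
       case: (eqVneq (s a) b) => [->|_]; rewrite ?(negPf bb) /=;
       try case: eqP => _ /=; lra).
  rewrite !sumrB sumr_const card_Sn !sum_perm1 !mulrBl divff //.
  rewrite mulrAC divff // mul1r mulr1 -/K.
  suff -> : 1 - K^-1 - K^-1 = (1 - K^-1) ^+ 2 - K^-1 ^+ 2.
    rewrite mulrDr mulr1 lerD2l; apply: (@le_trans _ _ 0).
      by rewrite oppr_le0 sqr_ge0.
    by rewrite mulr_ge0 ?sqr_ge0 // ltW.
  by ring.
- under eq_bigr => s _ do
    (have -> : ((s a != b) && (s a' != b))%:R
         = 1 - (s a == b)%:R - (s a' == b)%:R :> R by
       case: (eqVneq (s a) b) => [<-|_];
         rewrite ?(inj_eq perm_inj) 1?[a' == a]eq_sym ?(negPf aa) /=;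
       try case: eqP => _ /=; lra).
  rewrite !sumrB sumr_const card_Sn !sum_perm1 !mulrBl divff //.
  rewrite mulrAC divff // mul1r mulr1 -/K.
  suff -> : 1 - K^-1 - K^-1 = (1 - K^-1) ^+ 2 - K^-1 ^+ 2.
    rewrite mulrDr mulr1 lerD2l; apply: (@le_trans _ _ 0).
      by rewrite oppr_le0 sqr_ge0.
    by rewrite mulr_ge0 ?sqr_ge0 // ltW.
  by ring.
- under eq_bigr => s _ do
    (have -> : ((s a != b) && (s a' != b'))%:R
         = 1 - (s a == b)%:R - (s a' == b')%:R
           + ((s a == b) && (s a' == b'))%:R :> R by
       do 2 case: eqP => _ /=; lra).
  rewrite big_split /= !sumrB sumr_const card_Sn !sum_perm1 sum_perm2 //.
  rewrite kE -/K mulr1 le_eqVlt; apply/orP; left; apply/eqP.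
  by field; rewrite f0; lra.
Qed.

(** * Moments of the number of independent transversals *)

Definition graph_of (V : finType) (k : nat) (f : {ffun V -> 'I_k}) :
  {set V * 'I_k} := [set (v, f v) | v : V].

Lemma in_graph_of (V : finType) (k : nat) (f : {ffun V -> 'I_k}) v i :
  ((v, i) \in graph_of f) = (i == f v).
Proof.
apply/imsetP/eqP => [[u _ [-> ->]] //|->]; by exists v.
Qed.

Lemma transversal_graph_of (V : finType) (k : nat) (f : {ffun V -> 'I_k}) :
  Defs.transversal (@fiber V k) (graph_of f).
Proof.
apply/forallP => v; apply/cards1P; exists (v, f v).
apply/setP => -[u i]; rewrite !inE in_fiber in_graph_of xpair_eqE andbC /=.
by case: eqP => [->|].
Qed.

Definition matching (V : finType) (k : nat) (u v : V) (s : 'S_k) :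
  {set {set V * 'I_k}} := [set [set (u, i); (v, s i)] | i : 'I_k].

Lemma matching_inj (V : finType) (k : nat) (u v : V) :
  u != v -> injective (@matching V k u v).
Proof.
move=> uv s t est; apply/permP => i.
have : [set (u, i); (v, s i)] \in matching u v t.
  by rewrite -est; apply/imsetP; exists i.
case/imsetP => j _ /setP est'.
have := est' (u, i); rewrite !inE !xpair_eqE !eqxx (negPf uv) /= orbF.
move=> /esym/eqP eij; subst j.
have := est' (v, s i).
by rewrite !inE !xpair_eqE !eqxx orbT eq_sym (negPf uv) /= => /esym/eqP.
Qed.

Lemma independent_matching (V : finType) (k : nat) (u v : V) (s : 'S_k)
    (f : {ffun V -> 'I_k}) :
  independent (matching u v s) (graph_of f) = (s (f u) != f v).
Proof.
apply/forall_inP/idP => [h|h _ /imsetP[i _ ->]].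
  apply/eqP => sf; have /negP[] := h [set (u, f u); (v, s (f u))] (imset_f _ isT).
  by apply/subsetP => x; rewrite !inE => /orP[] /eqP->; rewrite in_graph_of ?sf.
apply/negP => /subsetP sub; case/negP: h.
have := sub (v, s i) (set22 _ _); have := sub (u, i) (set21 _ _).
by rewrite !in_graph_of => /eqP <-.
Qed.

Lemma sum_uniform_matching (R : realType) (V : finType) (k : nat) (u v : V)
    (F : {set {set V * 'I_k}} -> R) : u != v ->
  \sum_M uniform_pmf R (perfect_matchings k [set u; v]) M * F M
    = (\sum_(s : 'S_k) F (matching u v s)) / k`!%:R.
Proof.
move=> uv; rewrite /uniform_pmf card_perfect_matchings ?cards2 ?uv //.
have -> : perfect_matchings k [set u; v] = [set matching u v s | s : 'S_k].
  apply/setP => N; apply/(perfect_matchingsP _ uv)/imsetP.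
  - by case=> s ->; exists s.
  - by case=> s _ ->; exists s.
rewrite mulr_suml -[RHS](big_imset (fun M => F M / k`!%:R)); last first.
  by move=> s t _ _; exact: matching_inj.
rewrite [RHS]big_mkcond; apply: eq_bigr => M _.
by case: ifP; rewrite ?mul0r ?mul1r 1?mulrC.
Qed.

Lemma independent_cover (V : finType) (E : {set {set V}}) (k : nat)
    (w : outcome E k) (A : {set V * 'I_k}) :
  independent (cover_edges w) A = [forall e, independent (w e) A].
Proof.
apply/forall_inP/forallP => [h e|h B /bigcupP[e _ Be]].
  by apply/forall_inP => B Be; apply: h; apply/bigcupP; exists e.
by move/forall_inP: (h e); apply.
Qed.

Lemma natr_forall (R : realType) (I : finType) (P : pred I) :
  [forall i, P i]%:R = \prod_i (P i)%:R :> R.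
Proof.
case: (boolP [forall i, P i]) => [/forallP h|/forallPn[i /negPf h]].
  by rewrite big1 // => i _; rewrite h.
by rewrite (bigD1 i) //= h mul0r.
Qed.

(** Independence of the matchings of different edges. *)
Lemma expect_prod (R : realType) (V : finType) (E : {set {set V}}) (k : nat)
    (F : edge E -> {set {set V * 'I_k}} -> R) :
  \sum_(w : outcome E k) cover_pmf R w * \prod_e F e (w e)
    = \prod_e \sum_M uniform_pmf R (perfect_matchings k (val e)) M * F e M.
Proof.
rewrite bigA_distr_bigA /=; apply: eq_bigr => w _.
by rewrite -big_split.
Qed.

(** Counting maps rather than subsets, since every transversal is the graph of
    exactly one map. *)
Definition transversals_count (R : realType) (V : finType) (E : {set {set V}})
    (k : nat) (w : outcome E k) : R :=
  \sum_(f : {ffun V -> 'I_k}) (independent (cover_edges w) (graph_of f))%:R.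

Lemma card_edge (V : finType) (E : {set {set V}}) : #|edge E| = #|E|.
Proof. by rewrite card_sig; apply: eq_card. Qed.

Lemma first_moment (R : realType) (V : finType) (E : {set {set V}}) (k : nat) :
  simple_graph E ->
  \sum_(w : outcome E k) cover_pmf R w * transversals_count R w
    = k%:R ^+ #|V| * (1 - k%:R^-1) ^+ #|E|.
Proof.
move=> /forall_inP sE.
under eq_bigr => w _ do rewrite mulr_sumr.
rewrite exchange_big /=.
have key (f : {ffun V -> 'I_k}) : true ->
    \sum_(w : outcome E k)
      cover_pmf R w * (independent (cover_edges w) (graph_of f))%:R
    = (1 - k%:R^-1) ^+ #|E|.
  move=> _; under eq_bigr => w _ do rewrite independent_cover natr_forall.
  rewrite (expect_prod (fun e M => (independent M (graph_of f))%:R)).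
  rewrite -card_edge -prodr_const; apply: eq_bigr => e _.
  have /cards2P[u [v [uv ->]]] := sE _ (valP e).
  rewrite sum_uniform_matching //.
  under eq_bigr => s _ do rewrite independent_matching.
  exact: prob_avoid1.
rewrite (eq_bigr _ key) sumr_const card_ffun card_ord.
by rewrite -natrX mulr_natl.
Qed.

Definition agree (V : finType) (k : nat) (f g : {ffun V -> 'I_k}) : {set V} :=
  [set v | f v == g v].

Definition edges_in (V : finType) (E : {set {set V}}) (S : {set V}) :
  {set {set V}} := [set e in E | e \subset S].

(** Expand the square into pairs [(f, g)] and bound the factor of each edge by
    [prob_avoid2]; the factor k / (k - 1) occurs once for every edge inside the
    set where [f] and [g] agree. *)
Lemma second_moment (R : realType) (V : finType) (E : {set {set V}}) (k : nat) :
  simple_graph E -> (1 < k)%N ->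
  \sum_(w : outcome E k) cover_pmf R w * transversals_count R w ^+ 2
    <= ((1 - k%:R^-1) ^+ 2 * (1 + (k%:R - 1) ^- 3)) ^+ #|E|
       * \sum_(f : {ffun V -> 'I_k}) \sum_(g : {ffun V -> 'I_k})
           (k%:R / (k%:R - 1)) ^+ #|edges_in E (agree f g)|.
Proof.
move=> /forall_inP sE k1.
have -> : \sum_(w : outcome E k) cover_pmf R w * transversals_count R w ^+ 2
  = \sum_(f : {ffun V -> 'I_k}) \sum_(g : {ffun V -> 'I_k})
      \sum_(w : outcome E k) cover_pmf R w *
        ((independent (cover_edges w) (graph_of f))%:R
         * (independent (cover_edges w) (graph_of g))%:R).
  under [RHS]eq_bigr => f _ do rewrite exchange_big /=.
  rewrite [RHS]exchange_big /=; apply: eq_bigr => w _.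
  rewrite expr2 mulr_suml mulr_sumr; apply: eq_bigr => f _.
  by rewrite mulr_sumr mulr_sumr.
rewrite mulr_sumr; apply: ler_sum => f _.
rewrite mulr_sumr; apply: ler_sum => g _.
under eq_bigr => w _ do rewrite !independent_cover !natr_forall -big_split /=.
rewrite (expect_prod (fun e M => (independent M (graph_of f))%:R
   * (independent M (graph_of g))%:R)).
set q := (_ ^+ 2 * _); set r := (_ / _).
have -> : q ^+ #|E| * r ^+ #|edges_in E (agree f g)|
  = \prod_(e : edge E) (q * (if val e \subset agree f g then r else 1)).
  rewrite big_split /= prodr_const card_edge; congr (_ * _).
  rewrite -(big_sub (mem E) (fun e => if e \subset agree f g then r else 1)).
  rewrite -big_mkcondr /= -prodr_const; apply: eq_bigl => e; by rewrite !inE.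
apply: ler_prod => e _; apply/andP; split.
  apply: sumr_ge0 => M _; rewrite /uniform_pmf.
  by rewrite !mulr_ge0 // invr_ge0.
have /cards2P[u [v [uv ->]]] := sE _ (valP e).
rewrite sum_uniform_matching // subUset !sub1set !inE.
under eq_bigr => s _ do rewrite !independent_matching -natrM mulnb.
exact: prob_avoid2.
Qed.

(** The Cauchy-Schwarz inequality for the count and the indicator of colorability:
    the expectation of (1_colorable - t X)^2 is nonnegative. Optimizing over [t]
    would give t = E X / E X^2; replacing E X^2 by its upper bound there gives
    the choice made below. *)
Lemma second_moment_method (R : realType) (V : finType) (E : {set {set V}})
    (k : nat) (B : R) :
  simple_graph E -> (0 < B) ->
  let mean := \sum_(w : outcome E k) cover_pmf R w * transversals_count R w in
  0 < mean ->
  \sum_(w : outcome E k) cover_pmf R w * transversals_count R w ^+ 2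
    <= B * mean ^+ 2 ->
  B^-1 <= prob_DP_colorable R E k.
Proof.
move=> sE B0 mean mean0 hB.
set col := fun w : outcome E k => colorable (@fiber V k) (cover_edges w).
have X0 w : ~~ col w -> transversals_count R w = 0.
  move=> nc; apply: big1 => f _; case: (boolP (independent _ _)) => // ind.
  case/negP: nc; apply/existsP; exists (graph_of f).
  by rewrite transversal_graph_of.
pose t := (B * mean)^-1.
have t0 : 0 < t by rewrite invr_gt0 mulr_gt0.
have : 0 <= \sum_(w : outcome E k)
    cover_pmf R w * ((col w)%:R - t * transversals_count R w) ^+ 2.
  by apply: sumr_ge0 => w _; rewrite mulr_ge0 ?sqr_ge0 // cover_pmf_ge0.
have -> : \sum_(w : outcome E k)
    cover_pmf R w * ((col w)%:R - t * transversals_count R w) ^+ 2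
  = prob_DP_colorable R E k - 2 * t * mean
    + t ^+ 2 * \sum_(w : outcome E k) cover_pmf R w * transversals_count R w ^+ 2.
  rewrite /prob_DP_colorable /mean [X in _ = X - _ + _]big_mkcond.
  rewrite /= !mulr_sumr -sumrB -big_split /=.
  apply: eq_bigr => w _; rewrite -/(col w).
  by case: (boolP (col w)) => [_|/X0 ->]; rewrite /=; ring.
set Q := (X in _ + t ^+ 2 * X) => h.
have tQ : t ^+ 2 * Q <= t ^+ 2 * (B * mean ^+ 2) by rewrite ler_pM2l // exprn_gt0.
have tE : t ^+ 2 * (B * mean ^+ 2) = B^-1 by rewrite /t; field; lra.
have tm : t * mean = B^-1 by rewrite /t; field; lra.
rewrite tE in tQ; rewrite -mulrA tm in h; lra.
Qed.

(** * An explicit lower bound on the probability *)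

(** A nonempty [S] with the edges inside it is one of the subgraphs in the maximum;
    the empty set contains no edge. *)
Lemma edges_in_density (R : realType) (V : finType) (E : {set {set V}})
    (S : {set V}) : simple_graph E ->
  #|edges_in E S|%:R <= max_density R E * #|S|%:R.
Proof.
move=> /forall_inP sE; have [->|S0] := eqVneq S set0.
  rewrite cards0 mulr0 lern0 cards_eq0; apply/eqP/setP => e.
  rewrite !inE subset0; apply/andP => -[/sE h /eqP e0].
  by rewrite e0 cards0 in h.
rewrite -ler_pdivrMr ?ltr0n ?card_gt0 //.
apply: (le_bigmax_cond 0 (j := (S, edges_in E S))
  (fun S : {set V} * {set {set V}} => density R S.1 S.2)).
rewrite /= S0 /subgraph /=; apply/andP; split; apply/subsetP => e.
  by rewrite inE => /andP[].
by rewrite !inE => /andP[].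
Qed.

Lemma edges_in_square (V : finType) (E : {set {set V}}) (S : {set V}) :
  simple_graph E -> (#|edges_in E S| <= #|S| ^ 2)%N.
Proof.
move=> /forall_inP sE; apply: (@leq_trans 'C(#|S|, 2)).
  rewrite -cards_draws; apply/subset_leq_card/subsetP => e.
  by rewrite !inE => /andP[/sE -> ->].
rewrite bin2 (leq_trans (half_leq (leq_mul (leqnn _) (leq_pred _)))) //.
by rewrite mulnn -{2}[(_ ^ 2)%N]doubleK half_leq // -addnn leq_addr.
Qed.

Lemma expR_ge_pow (R : realType) (x : R) (n : nat) :
  0 <= x -> (1 + x) ^+ n <= expR (n%:R * x).
Proof.
move=> x0; rewrite expRM_natl; apply: lerXn2r; rewrite ?nnegrE ?expR_ge0 //.
  by rewrite addr_ge0.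
exact: expR_ge1Dx.
Qed.

(** The moment generating function of the number of agreements of [f] with a
    random map: the vertices contribute independent factors
    1 + (exp z - 1) / k, each at most 1 + exp z / k. *)
Lemma sum_agree (R : realType) (V : finType) (k : nat) (f : {ffun V -> 'I_k})
    (z : R) : (0 < k)%N ->
  \sum_(g : {ffun V -> 'I_k}) expR (#|agree f g|%:R * z)
    <= k%:R ^+ #|V| * expR (#|V|%:R * (expR z / k%:R)).
Proof.
move=> k0; have K0 : 0 < k%:R :> R by rewrite ltr0n.
under eq_bigr => g _.
  have -> : expR (#|agree f g|%:R * z)
      = \prod_v (if f v == g v then expR z else 1).
    rewrite expRM_natl -prodr_const big_mkcond /=.
    by apply: eq_bigr => v _; rewrite inE.
  over.
rewrite -(bigA_distr_bigA (fun v i => if f v == i then expR z else 1)) /=.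
have e0 : 0 <= expR z := expR_ge0 z.
have step v : true ->
    0 <= \sum_i (if f v == i then expR z else 1) <= k%:R * (1 + expR z / k%:R).
  move=> _; apply/andP; split.
    by apply: sumr_ge0 => i _; case: ifP.
  rewrite mulrDr mulr1 mulrCA divff ?mulr1; last by lra.
  apply: (@le_trans _ _
    (\sum_(i : 'I_k) (1 + if f v == i then expR z else 0))).
    by apply: ler_sum => i _; case: ifP => _; lra.
  rewrite big_split /= sumr_const card_ord -big_mkcond /=.
  by rewrite (big_pred1 (f v)) // => i; rewrite eq_sym.
apply: (@le_trans _ _ (\prod_(v : V) (k%:R * (1 + expR z / k%:R)))).
  by apply: ler_prod => v _; exact: step.
rewrite prodr_const exprMn ler_pM2l ?exprn_gt0 //.
by apply: expR_ge_pow; rewrite divr_ge0 // ltW.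
Qed.

(** The three terms dominate, respectively, when |S| <= J, when
    J < |S| <= k - 1 and when |S| > k - 1. Each of the last two is inflated by an
    exponential factor that is at least 1 in its range, so that it becomes
    negligible on average. *)
Lemma pointwise_bound (R : realType) (V : finType) (E : {set {set V}})
    (k : nat) (S : {set V}) (J : R) :
  simple_graph E -> (1 < k)%N ->
  (k%:R / (k%:R - 1)) ^+ #|edges_in E S|
  <= expR (J ^+ 2 / (k%:R - 1)) + expR (- J) * expR (#|S|%:R * 2)
     + expR (- (k%:R - 1))
       * expR (#|S|%:R * (1 + max_density R E / (k%:R - 1))).
Proof.
move=> sE k1; set K : R := k%:R.
have K1 : 0 < K - 1 by rewrite subr_gt0 ltr1n.
have Ki : 0 < (K - 1)^-1 by rewrite invr_gt0.
have -> : K / (K - 1) = 1 + (K - 1)^-1 by field; lra.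
apply: (le_trans (expR_ge_pow _ (ltW Ki))).
have := edges_in_density R S sE.
have := edges_in_square S sE; rewrite -(ler_nat R) natrX.
set e : R := #|edges_in E S|%:R; set N : R := #|S|%:R; set rho := max_density R E.
have N0 : 0 <= N by [].
move=> eN er; rewrite -!expRD.
have p1 := expR_ge0 (J ^+ 2 / (K - 1)).
have p2 := expR_ge0 (- J + N * 2).
have p3 := expR_ge0 (- (K - 1) + N * (1 + rho / (K - 1))).
have [NJ|JN] := leP N J.
  suff : expR (e / (K - 1)) <= expR (J ^+ 2 / (K - 1)) by lra.
  rewrite ler_expR ler_pM2r //; apply: (le_trans eN).
  by apply: lerXn2r => //; rewrite nnegrE (le_trans N0).
have [NK|KN] := leP N (K - 1).
  suff : expR (e / (K - 1)) <= expR (- J + N * 2) by lra.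
  rewrite ler_expR; suff : e / (K - 1) <= N by lra.
  rewrite ler_pdivrMr //; apply: (le_trans eN).
  by rewrite expr2 ler_wpM2l.
suff : expR (e / (K - 1)) <= expR (- (K - 1) + N * (1 + rho / (K - 1))) by lra.
rewrite ler_expR mulrDr mulr1.
suff : e / (K - 1) <= N * (rho / (K - 1)) by lra.
by rewrite mulrA ler_pM2r // mulrC.
Qed.

(** The leading factor comes from (1 + (k - 1)^-3)^m with m <= rho n; the sum is the
    average of [pointwise_bound] over all pairs of maps. *)
Lemma prob_DP_colorable_ge (R : realType) (V : finType) (E : {set {set V}})
    (k : nat) (J : R) :
  simple_graph E -> (1 < k)%N ->
  (expR (max_density R E * #|V|%:R / (k%:R - 1) ^+ 3)
   * (expR (J ^+ 2 / (k%:R - 1))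
      + expR (#|V|%:R * (expR 2 / k%:R) - J)
      + expR (#|V|%:R * (expR (1 + max_density R E / (k%:R - 1)) / k%:R)
              - (k%:R - 1))))^-1
  <= prob_DP_colorable R E k.
Proof.
move=> sE k1.
have k0 : (0 < k)%N by rewrite ltnW.
have K1 : 0 < k%:R - 1 :> R by rewrite subr_gt0 ltr1n.
have K0 : 0 < k%:R :> R by lra.
have q0 : 0 < 1 - k%:R^-1 :> R by rewrite subr_gt0 invf_lt1 //; lra.
apply: second_moment_method => //.
- by rewrite mulr_gt0 ?addr_gt0 ?expR_gt0.
- by rewrite first_moment // mulr_gt0 ?exprn_gt0.
rewrite first_moment //; apply: (le_trans (second_moment R sE k1)).
rewrite exprMn [(_ * _) ^+ 2]exprMn -!exprM [(#|E| * 2)%N]mulnC [(#|V| * 2)%N]mulnC.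
set n := #|V|; set rho := max_density R E.
set qm := (1 - _) ^+ (2 * #|E|); set D := (X in expR _ * X).
have qm0 : 0 < qm by rewrite exprn_gt0.
have Kn0 : 0 < k%:R ^+ n :> R by rewrite exprn_gt0.
have hc : (1 + (k%:R - 1) ^- 3) ^+ #|E| <= expR (rho * n%:R / (k%:R - 1) ^+ 3).
  apply: (le_trans (expR_ge_pow _ _)); first by rewrite invr_ge0 exprn_ge0 // ltW.
  rewrite ler_expR ler_pM2r ?invr_gt0 ?exprn_gt0 //.
  have := edges_in_density R [set: V] sE; rewrite cardsT.
  suff -> : edges_in E [set: V] = E by [].
  by apply/setP => e; rewrite inE subsetT andbT.
have hs : \sum_(f : {ffun V -> 'I_k}) \sum_(g : {ffun V -> 'I_k})
    (k%:R / (k%:R - 1)) ^+ #|edges_in E (agree f g)| <= k%:R ^+ n * (k%:R ^+ n * D).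
  have -> : k%:R ^+ n * (k%:R ^+ n * D) = \sum_(f : {ffun V -> 'I_k}) (k%:R ^+ n * D).
    by rewrite sumr_const card_ffun card_ord -[RHS]mulr_natl natrX.
  apply: ler_sum => f _.
  apply: (le_trans (ler_sum _ (fun g _ => pointwise_bound (agree f g) J sE k1))).
  rewrite !big_split /= sumr_const card_ffun card_ord -!mulr_sumr /D.
  have h2 := sum_agree f (2 : R) k0.
  have h3 := sum_agree f (1 + rho / (k%:R - 1) : R) k0.
  rewrite -[_ *+ _]mulr_natl natrX !mulrDr -/n.
  apply: lerD; first apply: lerD => //.
    apply: le_trans (ler_wpM2l (expR_ge0 _) h2) _.
    by rewrite mulrCA -expRD addrC.
  apply: le_trans (ler_wpM2l (expR_ge0 _) h3) _.
  by rewrite mulrCA -expRD addrC.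
have D0 : 0 < D by rewrite !addr_gt0 ?expR_gt0.
have -> : expR (rho * n%:R / (k%:R - 1) ^+ 3) * D * (k%:R ^+ (2 * n) * qm)
  = qm * expR (rho * n%:R / (k%:R - 1) ^+ 3) * (k%:R ^+ n * (k%:R ^+ n * D)).
  by rewrite mul2n -addnn exprD; ring.
apply: ler_pM => //.
- apply: mulr_ge0; first exact: ltW.
  by rewrite exprn_ge0 // addr_ge0 // invr_ge0 exprn_ge0 // ltW.
- do 2 (apply: sumr_ge0 => ? _).
  by rewrite exprn_ge0 // divr_ge0 // ltW.
- by rewrite ler_pM2l.
Qed.

(** * Asymptotics *)

(** The room [4 * d] in the exponents that absorbs all polynomial factors in
    y = ln rho. With a = 1 / (1 - s) the three gaps 2 - a, 3 - 2 a and
    2 - a - b are positive, where b = (2 - a) / (1 + eps / 2): the first two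
    because a < 3 / 2, the last one because eps > 0. *)
Lemma exponent_gap (R : realType) (eps s : R) :
  0 < eps -> 0 <= s -> s < 1 / 3 ->
  exists d : R, [/\ 0 < d, 4 * d <= 1,
    4 * d <= 2 - (1 - s)^-1,
    4 * d <= 3 - 2 * (1 - s)^-1 &
    4 * d <= 2 - (1 - s)^-1 - (2 - (1 - s)^-1) / (1 + eps / 2)].
Proof.
move=> e0 s0 s3; set a := (1 - s)^-1.
have a1 : 1 <= a by rewrite invf_ge1; lra.
have a2 : a < 3 / 2.
  rewrite -[ltRHS]invrK ltf_pV2 ?posrE ?invr_gt0; lra.
have g0 : 0 < 2 - a - (2 - a) / (1 + eps / 2).
  rewrite subr_gt0 ltr_pdivrMr; last by lra.
  by rewrite ltr_pMr; lra.
set g := 2 - a - _ in g0 *.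
exists (Num.min (2 - a) (Num.min (3 - 2 * a) g) / 4).
have h : 0 < Num.min (2 - a) (Num.min (3 - 2 * a) g).
  by rewrite !lt_min; lra.
have m1 : Num.min (2 - a) (Num.min (3 - 2 * a) g) <= 2 - a by rewrite ge_min lexx.
have m2 : Num.min (2 - a) (Num.min (3 - 2 * a) g) <= 3 - 2 * a.
  by rewrite !ge_min lexx orbT.
have m3 : Num.min (2 - a) (Num.min (3 - 2 * a) g) <= g.
  by rewrite !ge_min lexx !orbT.
by split; lra.
Qed.

(** Here [y] stands for ln rho and [K] for k. With t = exp (- d y), the hypothesis on
    [K] gives K - 1 >= exp ((1 - d) y) >= 1 / t, and each of the quantities to be
    bounded is at most a constant times [t] (in the last one, the positive term
    is at most a constant times t (K - 1)). The constant [W] below collects what is then required of 1 / t. *)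
Lemma eventually_small_errors (R : realType) (eps s eta L : R) :
  0 < eps -> 0 <= s -> s < 1 / 3 -> 0 < eta -> 0 < L ->
  exists2 y0 : R, 0 < y0 & forall y n K : R,
    y0 <= y -> 0 <= n -> n <= expR (y / (1 - s)) ->
    (1 + eps) * (1 + s / (1 - 2 * s)) * (expR y / y) <= K ->
    [/\ 2 <= K,
        expR y * n / (K - 1) ^+ 3 <= eta,
        (n * (expR 2 / K) + L) ^+ 2 / (K - 1) <= eta &
        n * (expR (1 + expR y / (K - 1)) / K) - (K - 1) <= - L].
Proof.
move=> e0 s0 s3 eta0 L0.
have [d [d0 d1 da d2a db]] := exponent_gap e0 s0 s3.
have aE x : x / (1 - s) = (1 - s)^-1 * x by rewrite mulrC.
have DE : (1 + eps) * (1 + s / (1 - 2 * s)) = (1 + eps) / (2 - (1 - s)^-1).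
  by field; lra.
rewrite DE; set a := (1 - s)^-1 in aE da d2a db *.
set b := (2 - a) / (1 + eps / 2) in db.
pose c : R := expR 2.
pose W := 2 + eta^-1 * (1 + 2 * c ^+ 2 + 2 * L ^+ 2) + 2 * expR 1 + 2 * L + 2 / eps.
have ei : 0 < eta^-1 by rewrite invr_gt0.
have c0 : 0 <= c ^+ 2 by rewrite sqr_ge0.
have l0 : 0 <= L ^+ 2 by rewrite sqr_ge0.
have ec0 : 0 <= eta^-1 * (1 + 2 * c ^+ 2 + 2 * L ^+ 2) by rewrite mulr_ge0; lra.
have E0 : 0 < expR 1 :> R := expR_gt0 _.
have ie0 : 0 < 2 / eps by rewrite divr_gt0.
have W0 : 2 < W by rewrite /W; lra.
exists (1 + 8 / d ^+ 2 + W / d).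
  by rewrite !addr_gt0 ?divr_gt0 ?exprn_gt0 //; lra.
move=> y n K hy n0 nle Kge.
have d20 : 0 < 8 / d ^+ 2 by rewrite divr_gt0 ?exprn_gt0.
have Wd0 : 0 < W / d by rewrite divr_gt0 //; lra.
have y1 : 1 < y by lra.
have dy : W <= d * y by rewrite mulrC -ler_pdivrMr //; lra.
set t := expR (- (d * y)).
have t0 : 0 < t := expR_gt0 _.
have tV : t^-1 = expR (d * y) by rewrite /t expRN invrK.
have tW : W <= t^-1.
  rewrite tV; apply: le_trans dy _; have := expR_ge1Dx (d * y); lra.
(* 1 / t is a square, so its linear lower bound yields a quadratic one. *)
have yt : 2 * y <= t^-1.
  have dd : 8 <= y * d ^+ 2 by rewrite -ler_pdivrMr ?exprn_gt0 //; lra.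
  have u1 := expR_ge1Dx (d * y / 2).
  have -> : t^-1 = expR (d * y / 2) * expR (d * y / 2).
    by rewrite -expRD tV; congr expR; field.
  apply: (@le_trans _ _ ((d * y / 2) * (d * y / 2))).
    have -> : d * y / 2 * (d * y / 2) = (y * d ^+ 2) * (y / 4) by field.
    have : 8 * (y / 4) <= (y * d ^+ 2) * (y / 4) by rewrite ler_pM2r; lra.
    lra.
  have : 0 < d * y by rewrite mulr_gt0; lra.
  by move=> dy0; apply: ler_pM; lra.
have K2 : 2 * expR ((1 - d) * y) <= K.
  apply: le_trans Kge.
  have -> : expR ((1 - d) * y) = expR y * t.
    by rewrite /t -expRD; congr expR; ring.
  have h1 : 1 <= (1 + eps) / (2 - a).
    have a1 : 1 <= a by rewrite invf_ge1; lra.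
    by rewrite ler_pdivlMr; lra.
  have h2 : 2 * (expR y * t) <= expR y / y.
    rewrite ler_pdivlMr; last by lra.
    have -> : 2 * (expR y * t) * y = expR y * (2 * y * t) by ring.
    rewrite ler_piMr ?expR_ge0 // -ler_pdivlMr //.
    by rewrite mul1r.
  have h3 : 0 <= expR y / y by rewrite divr_ge0 ?expR_ge0 //; lra.
  apply: le_trans h2 _; by rewrite ler_peMl.
set M := K - 1 in Kge K2 *.
have dly : d * y <= (1 - d) * y by rewrite ler_pM2r; lra.
have Q1 : t^-1 <= expR ((1 - d) * y) by rewrite tV ler_expR.
have M0 : expR ((1 - d) * y) <= M by rewrite /M; lra.
have Mpos : 0 < M by lra.
have MW : W <= M by lra.
have KM : M <= K by rewrite /M; lra.
have Kpos : 0 < K by lra.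
have M3 : expR ((1 - d) * y) ^+ 3 <= M ^+ 3.
  by rewrite lerXn2r // nnegrE ?expR_ge0 // ltW.
have cube : expR ((1 - d) * y) ^+ 3 = expR (3 * ((1 - d) * y)) by rewrite -expRM_natl.
(* The errors of the form x / k^3: a gain of exp ((z - 3) y) against a loss of
   exp (3 d y). *)
have bound3 z x : 0 <= x -> x <= expR (z * y) -> z - 3 + 3 * d <= - d -> x / M ^+ 3 <= t.
  move=> x0 xz zd; rewrite ler_pdivrMr ?exprn_gt0 //.
  apply: le_trans xz _; apply: (@le_trans _ _ (t * expR ((1 - d) * y) ^+ 3)).
    rewrite cube /t -expRD ler_expR.
    have : (z - 3 + 3 * d) * y <= - d * y by rewrite ler_pM2r //; lra.
    lra.
  by rewrite ler_pM2l.
rewrite aE in nle.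
have tet C : C <= W * eta -> C * t <= eta.
  move=> CW; rewrite -ler_pdivlMr //; apply: le_trans CW _.
  by rewrite mulrC ler_pM2l.
have WE : 1 + 2 * c ^+ 2 + 2 * L ^+ 2 <= W * eta.
  have -> : 1 + 2 * c ^+ 2 + 2 * L ^+ 2 = eta^-1 * (1 + 2 * c ^+ 2 + 2 * L ^+ 2) * eta.
    by field; lra.
  rewrite ler_pM2r // /W; lra.
split.
- lra.
- apply: (@le_trans _ _ t).
    apply: (bound3 (1 + a)); rewrite ?mulr_ge0 ?expR_ge0 //; last by lra.
    by rewrite mulrDl mul1r expRD ler_pM2l ?expR_gt0.
  rewrite -[t]mul1r; apply: tet; lra.
- have nK : n * (c / K) <= n * c / M.
    rewrite mulrA ler_wpM2l ?mulr_ge0 ?expR_ge0 //.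
    by rewrite lef_pV2 ?posrE.
  have nK0 : 0 <= n * (c / K) by rewrite !mulr_ge0 ?invr_ge0 ?expR_ge0 //; lra.
  have sq : (n * (c / K) + L) ^+ 2 <= 2 * (n * c / M) ^+ 2 + 2 * L ^+ 2.
    have s1 : (n * (c / K)) ^+ 2 <= (n * c / M) ^+ 2.
      by apply: lerXn2r; rewrite ?nnegrE //; lra.
    have := sqr_ge0 (n * (c / K) - L); rewrite sqrrB sqrrD; lra.
  apply: (@le_trans _ _ ((2 * (n * c / M) ^+ 2 + 2 * L ^+ 2) / M)).
    by rewrite ler_pM2r ?invr_gt0.
  have -> : (2 * (n * c / M) ^+ 2 + 2 * L ^+ 2) / M
     = 2 * c ^+ 2 * (n ^+ 2 / M ^+ 3) + 2 * L ^+ 2 * M^-1 by field; lra.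
  have n2 : n ^+ 2 / M ^+ 3 <= t.
    apply: (bound3 (2 * a)); rewrite ?sqr_ge0 //; last by lra.
    rewrite -mulrA expRM_natl; apply: lerXn2r => //.
    by rewrite nnegrE expR_ge0.
  have Mt : M^-1 <= t.
    by rewrite -[t]invrK lef_pV2 ?posrE ?invr_gt0 //; lra.
  apply: (@le_trans _ _ (2 * c ^+ 2 * t + 2 * L ^+ 2 * t)).
    by apply: lerD; apply: ler_wpM2l => //; lra.
  rewrite -mulrDl; apply: tet; lra.
- have rM : expR y / M <= b * y.
    rewrite ler_pdivrMr //.
    have ee : 0 < 1 + eps / 2 by lra.
    (* Passing from K to K - 1 costs part of eps, which is why b involves eps / 2. *)
    have MK : (1 + eps / 2) * K <= (1 + eps) * M.
      have : 2 / eps <= M by apply: le_trans MW; rewrite /W; lra.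
      rewrite ler_pdivrMr // => h.
      have : W * eps <= M * eps by rewrite ler_pM2r.
      have : (2 + 2 / eps) * eps <= W * eps by rewrite ler_pM2r // /W; lra.
      have -> : (2 + 2 / eps) * eps = 2 * eps + 2 by field; lra.
      rewrite /M in h *; lra.
    have hK : expR y <= K * ((2 - a) / (1 + eps)) * y.
      move: Kge; rewrite mulrA ler_pdivrMr; last by lra.
      move=> h.
      have -> : expR y = (1 + eps) / (2 - a) * expR y * ((2 - a) / (1 + eps)).
        by field; lra.
      have -> : K * ((2 - a) / (1 + eps)) * y = K * y * ((2 - a) / (1 + eps)) by ring.
      by rewrite ler_pM2r // divr_gt0; lra.
    apply: le_trans hK _.
    have -> : K * ((2 - a) / (1 + eps)) * y
      = ((1 + eps / 2) * K) * ((2 - a) * y / ((1 + eps) * (1 + eps / 2))).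
      by field; lra.
    have -> : b * y * M
      = ((1 + eps) * M) * ((2 - a) * y / ((1 + eps) * (1 + eps / 2))).
      by rewrite /b; field; lra.
    rewrite ler_pM2r // divr_gt0 // mulr_gt0; lra.
  have h1 : n * (expR (1 + expR y / M) / K) <= M / 2.
    rewrite mulrA ler_pdivrMr //.
    apply: (@le_trans _ _ (expR (a * y) * expR (1 + b * y))).
      apply: ler_pM => //; rewrite ?expR_ge0 // ler_expR; lra.
    have -> : expR (a * y) * expR (1 + b * y)
       = expR 1 * expR ((a + b - 2 + 2 * d) * y) * expR ((1 - d) * y) ^+ 2.
      by rewrite -expRM_natl -!expRD; congr expR; ring.
    have q : expR ((a + b - 2 + 2 * d) * y) <= t.
      rewrite ler_expR -mulNr ler_pM2r; lra.
    have q2 : expR 1 * t <= 1 / 2.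
      rewrite -ler_pdivlMr // ; apply: le_trans (_ : t^-1 / 2 <= _); rewrite ?div1r; last by lra.
      rewrite /W in tW; lra.
    have q3 : expR 1 * expR ((a + b - 2 + 2 * d) * y) <= 1 / 2.
      by apply: le_trans q2; rewrite ler_pM2l.
    have -> : M / 2 * K = 1 / 2 * (M * K) by ring.
    apply: ler_pM => //; rewrite ?exprn_ge0 ?mulr_ge0 ?expR_ge0 //.
    rewrite expr2; apply: ler_pM; rewrite ?expR_ge0 //; lra.
  have h2 : 2 * L <= M by apply: le_trans MW; rewrite /W; lra.
  lra.
Qed.

Theorem theorem1p2 (R : realType) (eps s : R)
    (eps_gt0 : 0 < eps) (s_ge0 : 0 <= s) (s_lt : s < 1 / 3) :
  exists n0 : nat,
    forall (V : finType) (E : {set {set V}}),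
      simple_graph E ->
      (n0 <= #|V|)%N ->
      #|V|%:R `^ (1 - s) <= max_density R E ->
      forall k : nat,
        (1 + eps) * (1 + s / (1 - 2 * s))
          * (max_density R E / ln (max_density R E)) <= k%:R ->
        1 - eps <= prob_DP_colorable R E k.
Proof.
pose eta := eps / 4.
have eta0 : 0 < eta by rewrite divr_gt0.
(* Any L with exp (- L) <= eta would do. *)
pose L := eta^-1.
have L0 : 0 < L by rewrite invr_gt0.
have [y0 y0_gt0 asym] := eventually_small_errors eps_gt0 s_ge0 s_lt eta0 L0.
exists (Num.bound (expR (y0 / (1 - s)))).
move=> V E sE nV dense k kge; set rho := max_density R E in dense kge.
set n : R := #|V|%:R in dense.
have s1 : 0 < 1 - s by lra.
have nle : expR (y0 / (1 - s)) <= n.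
  apply: (@le_trans _ _ (Num.bound (expR (y0 / (1 - s))))%:R).
    by rewrite ltW // archi_boundP ?expR_ge0.
  by rewrite ler_nat.
have n0 : 0 < n by apply: lt_le_trans nle; exact: expR_gt0.
have rho0 : 0 < rho by apply: lt_le_trans dense; exact: powR_gt0.
have lnle : (1 - s) * ln n <= ln rho.
  by rewrite -ln_powR ler_ln ?posrE // powR_gt0.
have y_ge : y0 <= ln rho.
  apply: le_trans lnle; rewrite mulrC -ler_pdivrMr //.
  by rewrite -[leLHS]expRK ler_ln ?posrE ?expR_gt0.
have n_le : n <= expR (ln rho / (1 - s)).
  rewrite -[n]lnK ?posrE // ler_expR ler_pdivlMr //.
  by rewrite mulrC.
have rhoE : expR (ln rho) = rho by rewrite lnK // posrE.
have := asym _ n k%:R y_ge (ltW n0) n_le; rewrite rhoE => /(_ kge)[k2 a1 a2 a3].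
have k1 : (1 < k)%N by rewrite -(ler_nat R).
apply: le_trans (prob_DP_colorable_ge (n * (expR 2 / k%:R) + L) sE k1).
rewrite -/rho -/n.
(* It suffices to bound the second moment ratio by exp eps = exp eta * exp (3 eta),
   as exp (- eps) >= 1 - eps. *)
apply: (@le_trans _ _ (expR (- eps))); first by have := expR_ge1Dx (- eps); lra.
rewrite expRN lef_pV2 ?posrE ?mulr_gt0 ?addr_gt0 ?expR_gt0 //.
have -> : eps = eta + (eta + 2 * eta) by rewrite /eta; field.
have eL : expR (- L) <= eta.
  rewrite expRN -[leRHS]invrK lef_pV2 ?posrE ?expR_gt0 ?invr_gt0 //.
  have := expR_ge1Dx L; rewrite /L; lra.
rewrite [expR (_ + (_ + _))]expRD; apply: ler_pM; rewrite ?addr_ge0 ?expR_ge0 ?ler_expR //.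
apply: (@le_trans _ _ (expR eta + expR (- L) + expR (- L))).
  apply: lerD; [apply: lerD|]; rewrite ler_expR //.
  by rewrite opprD addNKr.
apply: (@le_trans _ _ (expR eta * (1 + 2 * eta))); last first.
  rewrite expRD ler_pM2l ?expR_gt0 //; exact: expR_ge1Dx.
have : 1 <= expR eta by have := expR_ge1Dx eta; lra.
nra.
Qed.
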